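(* Let $0<\delta<1$ and $w>e$, and let the number of samples $K\in\mathbb{N}$ satisfy $$K\ \geq\ \max\left\{\frac{2\log(2\,\#\mathcal{P})+2\log(\delta^{-1})}{\log(w/e)},\ 3\right\}.$$ Then the estimators $\widetilde\Delta^{\mathrm{rel}}(\mu)$ and $\widetilde\Delta^{\mathrm{rel}}$ satisfy $$\mathbb{P}\Big\{ (\alpha^{\mathrm{rel}}_\infty w)^{-1}\widetilde\Delta^{\mathrm{rel}}(\mu)\leq \frac{\|u(\mu)-\widetilde u(\mu)\|_\Sigma}{\|u(\mu)\|_\Sigma}\leq (\alpha^{\mathrm{rel}}_\infty w)\,\widetilde\Delta^{\mathrm{rel}}(\mu)\ \text{ for all }\mu\in\mathcal{P}\Big\}\geq 1-\delta$$ and $$\mathbb{P}\Bigg\{ (\alpha^{\mathrm{rel}}_2 w)^{-1}\widetilde\Delta^{\mathrm{rel}}\leq \frac{\sqrt{\tfrac{1}{\#\mathcal{P}}\sum_{\mu\in\mathcal{P}}\|u(\mu)-\widetilde u(\mu)\|_\Sigma^2}}{\sqrt{\tfrac{1}{\#\mathcal{P}}\sum_{\mu\in\mathcal{P}}\|u(\mu)\|_\Sigma^2}}\leq (\alpha^{\mathrm{rel}}_2 w)\,\widetilde\Delta^{\mathrm{rel}}\Bigg\}\geq 1-\delta,$$ where $$\alpha^{\mathrm{rel}}_\infty:=\max_{\mu\in\mathcal{P}}\left(\max\left\{\frac{\Delta^{\mathrm{rel}}(\mu)}{\widetilde\Delta^{\mathrm{rel}}(\mu)},\frac{\widetilde\Delta^{\mathrm{rel}}(\mu)}{\Delta^{\mathrm{rel}}(\mu)}\right\}\right)\geq1\qquad\text{and}\qquad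 \alpha^{\mathrm{rel}}_2:=\max\left\{\frac{\Delta^{\mathrm{rel}}}{\widetilde\Delta^{\mathrm{rel}}},\frac{\widetilde\Delta^{\mathrm{rel}}}{\Delta^{\mathrm{rel}}}\right\}\geq 1 .$$
   Context: Setting. $\mathcal{P}=\mathcal{P}_1\times\cdots\times\mathcal{P}_p\subset\mathbb{R}^p$ is a nonempty finite parameter set (each $\mathcal{P}_i\subset\mathbb{R}$ finite), with cardinality $\#\mathcal{P}$. For each $\mu=(\mu_1,\dots,\mu_p)\in\mathcal{P}$, $A(\mu)\in\mathbb{R}^{N\times N}$ is an invertible matrix, $f(\mu)\in\mathbb{R}^N$, and $u(\mu)\in\mathbb{R}^N$ is the solution of $A(\mu)u(\mu)=f(\mu)$. An approximation of $u$ is a given deterministic function $\widetilde u:\mathcal{P}\to\mathbb{R}^N$ of the separated form $\widetilde u(\mu)=\sum_{m=1}^M u^m_{\mathcal X}\,u^m_1(\mu_1)\cdots u^m_p(\mu_p)$ with $u^m_{\mathcal X}\in\mathbb{R}^N$ and $u^m_i:\mathcal{P}_i\to\mathbb{R}$. The residual is $r(\mu)=f(\mu)-A(\mu)\widetilde u(\mu)$. $\Sigma\in\mathbb{R}^{N\times N}$ is a symmetric positive semi-definite matrix and $\|v\|_\Sigma=\sqrt{v^T\Sigma v}$. It is assumed that $\|u(\mu)\|_\Sigma\neq0$ for all $\mu\in\mathcal{P}$. $Z_1,\dots,Z_K$ are independent Gaussian random vectors in $\mathbb{R}^N$ with mean zero and covariance $\Sigma$ (possibly singular). $Y_i(\mu)\in\mathbb{R}^N$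 denotes the solution of the random dual problem $A(\mu)^TY_i(\mu)=Z_i$, $1\leq i\leq K$, and $$\Delta^{\mathrm{rel}}(\mu)=\sqrt{\frac{\frac1K\sum_{i=1}^K(Y_i(\mu)^Tr(\mu))^2}{\frac1K\sum_{i=1}^K(Y_i(\mu)^Tf(\mu))^2}},\qquad \Delta^{\mathrm{rel}}=\sqrt{\frac{\frac{1}{K\#\mathcal{P}}\sum_{\mu\in\mathcal{P}}\sum_{i=1}^K(Y_i(\mu)^Tr(\mu))^2}{\frac{1}{K\#\mathcal{P}}\sum_{\mu\in\mathcal{P}}\sum_{i=1}^K(Y_i(\mu)^Tf(\mu))^2}}.$$ The matrix $Y(\mu)=[Y_1(\mu),\dots,Y_K(\mu)]\in\mathbb{R}^{N\times K}$ is approximated by a matrix of separated form $\widetilde Y(\mu)=\sum_{m=1}^L Y^m_{\mathcal X}\,Y^m_1(\mu_1)\cdots Y^m_p(\mu_p)$ with $Y^m_{\mathcal X}\in\mathbb{R}^{N\times K}$ and $Y^m_i:\mathcal{P}_i\to\mathbb{R}$, computed from $Z_1,\dots,Z_K$ (so it is random and may depend on $Z_1,\dots,Z_K$; its entries are random variables). No accuracy of this approximation is assumed. $\widetilde Y_i(\mu)$ denotes the $i$-th column of $\widetilde Y(\mu)$. The fast-to-evaluate relative estimators are $$\widetilde\Delta^{\mathrm{rel}}(\mu)=\sqrt{\frac{\frac1K\sum_{i=1}^K(\widetilde Y_i(\mu)^Tr(\mu))^2}{\frac1K\sum_{i=1}^K(\widetilde Y_i(\mu)^Tf(\mu))^2}},\qquad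 \widetilde\Delta^{\mathrm{rel}}=\sqrt{\frac{\frac{1}{K\#\mathcal{P}}\sum_{\mu\in\mathcal{P}}\sum_{i=1}^K(\widetilde Y_i(\mu)^Tr(\mu))^2}{\frac{1}{K\#\mathcal{P}}\sum_{\mu\in\mathcal{P}}\sum_{i=1}^K(\widetilde Y_i(\mu)^Tf(\mu))^2}}.$$ The numbers $\alpha^{\mathrm{rel}}_\infty$ and $\alpha^{\mathrm{rel}}_2$ are random (they depend on $Z_1,\dots,Z_K$); it is assumed that almost surely all denominators in the definitions of the estimators and of $\alpha^{\mathrm{rel}}_\infty,\alpha^{\mathrm{rel}}_2$ are nonzero. $\log$ is the natural logarithm and $e=\exp(1)$. *)

(* Defs.v *)
From HB Require Import structures.
From mathcomp Require Import all_boot all_order all_algebra finmap.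
From mathcomp Require Import all_classical all_reals all_analysis.
Set Implicit Arguments.
Unset Strict Implicit.
Unset Printing Implicit Defensive.
Import Order.TTheory GRing.Theory Num.Theory.
Import numFieldNormedType.Exports.
Local Open Scope classical_set_scope.
Local Open Scope ring_scope.

(* The product set P_1 x ... x P_p as a finite type: mu i has type P i, and
   \val (mu i) is the i-th real coordinate of mu. *)
Notation param P := {dffun forall i : 'I__, fset_sub_type (P i)}.

Definition separated_form (R : realType) (V : lmodType R) (p n : nat)
    (P : 'I_p -> {fset R}) (vX : 'I_n -> V) (v : 'I_n -> forall i, P i -> R)
    (mu : param P) : V :=
  \sum_(m < n) (\prod_(i < p) v m i (mu i)) *: vX m.

Definition dotv (R : realType) (N : nat) (x y : 'cV[R]_N) : R :=
  (x^T *m y) 0 0.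

Definition is_psd (R : realType) (N : nat) (S : 'M[R]_N) : Prop :=
  forall v : 'cV[R]_N, 0 <= dotv v (S *m v).

Definition normS (R : realType) (N : nat) (S : 'M[R]_N) (v : 'cV[R]_N) : R :=
  Num.sqrt (dotv v (S *m v)).

Notation borelcV R N := (g_sigma_algebraType (@open 'cV[R]_N)).

(* The law N(m, s^2) on the line. In the library, normal_prob m 0 is a
   placeholder (the uniform law on [0, 1]), hence the case distinction. *)
Definition normal_law (R : realType) (m s : R) (B : set R) : \bar R :=
  if s == 0 then \d_m B else normal_prob m s B.

Definition gaussian_vector (R : realType) (d : measure_display)
    (Omega : measurableType d) (Pr : probability Omega R) (N : nat)
    (Z : Omega -> 'cV[R]_N) : Prop :=
  forall v : 'cV[R]_N, exists m s : R, forall B : set R,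
    measurable B -> Pr [set w | B (dotv v (Z w))] = normal_law m s B.

Definition has_mean (R : realType) (d : measure_display)
    (Omega : measurableType d) (Pr : probability Omega R) (N : nat)
    (Z : Omega -> 'cV[R]_N) (a : 'cV[R]_N) : Prop :=
  forall j, expectation Pr (fun w => Z w j 0) = (a j 0)%:E.

Definition has_covariance (R : realType) (d : measure_display)
    (Omega : measurableType d) (Pr : probability Omega R) (N : nat)
    (Z : Omega -> 'cV[R]_N) (S : 'M[R]_N) : Prop :=
  forall j k,
    covariance Pr (fun w => Z w j 0) (fun w => Z w k 0) = (S j k)%:E.

Definition independent_vectors (R : realType) (d : measure_display)
    (Omega : measurableType d) (Pr : probability Omega R) (N K : nat)
    (Z : 'I_K -> Omega -> 'cV[R]_N) : Prop :=
  forall B : 'I_K -> set (borelcV R N), (forall i, measurable (B i)) ->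
    Pr (\bigcap_i (Z i @^-1` B i)) = (\prod_(i < K) Pr (Z i @^-1` B i))%E.

Definition residual (R : realType) (T : Type) (N : nat) (A : T -> 'M[R]_N)
    (f ut : T -> 'cV[R]_N) (mu : T) : 'cV[R]_N :=
  f mu - A mu *m ut mu.

Section Estimators.
Context (R : realType) (T : finType) (N K : nat).
Implicit Types (Y Yt : T -> 'M[R]_(N, K)) (r f g : T -> 'cV[R]_N).

Definition msq_at Y g (mu : T) : R :=
  K%:R^-1 * \sum_(i < K) (dotv (col i (Y mu)) (g mu)) ^+ 2.

Definition msq Y g : R :=
  (K%:R * #|T|%:R)^-1
    * \sum_(mu : T) \sum_(i < K) (dotv (col i (Y mu)) (g mu)) ^+ 2.

(* Delta^rel(mu) and Delta^rel when Y holds the exact dual solutions, their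
   fast-to-evaluate versions when Y is replaced by its approximation. *)
Definition Delta_at Y r f (mu : T) : R :=
  Num.sqrt (msq_at Y r mu / msq_at Y f mu).

Definition Delta Y r f : R := Num.sqrt (msq Y r / msq Y f).

(* The ratios are nonnegative, so the default value 0 does not affect the
   maximum over a nonempty T. *)
Definition alpha_infty Y Yt r f : R :=
  \big[Num.max/0]_(mu : T)
    Num.max (Delta_at Y r f mu / Delta_at Yt r f mu)
            (Delta_at Yt r f mu / Delta_at Y r f mu).

Definition alpha_2 Y Yt r f : R :=
  Num.max (Delta Y r f / Delta Yt r f) (Delta Yt r f / Delta Y r f).

Definition denominators_neq0 Y Yt r f : Prop :=
  (forall mu, [/\ msq_at Y f mu != 0, msq_at Yt f mu != 0,
                  Delta_at Y r f mu != 0 & Delta_at Yt r f mu != 0]) /\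
  [/\ msq Y f != 0, msq Yt f != 0, Delta Y r f != 0 & Delta Yt r f != 0].

Definition rms_norm (S : 'M[R]_N) g : R :=
  Num.sqrt (#|T|%:R^-1 * \sum_(mu : T) normS S (g mu) ^+ 2).

End Estimators.

(* Main.v *)
(* Since [A mu ^T Y_i = Z_i], the products [Y_i^T f] and [Y_i^T r] at [mu] are
   [Z_i^T u] and [Z_i^T (u - ut)]. For a fixed vector [v] the variables [Z_i^T v]
   are independent with law N(0, |v|^2), where |v| is the [Sigma]-norm, so Chernoff
   bounds with optimal exponents on both sides show that
   [|v|^2 / w <= 1/K \sum_i (Z_i^T v)^2 <= w |v|^2] fails with probability at most
   (e / w)^(K / 2) as soon as [K >= 3]. A union bound over the [2 #P] vectors
   [u mu], [u mu - ut mu] leaves one event on which [Delta] is within a factor [w]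
   of the true relative error, both at each [mu] and, after summing over [mu], in
   mean square; [alpha] is by definition a factor within which [Delta] and its fast
   version agree. *)
Require Import Defs.
From HB Require Import structures.
From mathcomp Require Import all_boot all_order all_algebra finmap.
From mathcomp Require Import all_classical all_reals all_analysis measurable_realfun.
From mathcomp Require Import ring lra.
Set Implicit Arguments.
Unset Strict Implicit.
Unset Printing Implicit Defensive.
Import Order.TTheory GRing.Theory Num.Theory.
Import numFieldNormedType.Exports.
Local Open Scope classical_set_scope.
Local Open Scope ring_scope.

(** * Numerical inequalities behind the threshold [K >= 3] *)

(* [1 + 1/128] is squared seven times, with rounding down at each step. *)
Lemma expR1_ge_27_10 (R : realType) : 27 / 10 <= expR 1 :> R.
Proof.
have sq (a b x : R) : 0 <= a -> a <= expR x -> b <= a ^+ 2 -> b <= expR (x + x).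
  by move=> a0 ax /le_trans; apply; rewrite expRD -expr2 lerXn2r ?nnegrE ?expR_ge0.
have h0 : 129 / 128 <= expR (1 / 128) :> R.
  by apply: le_trans (expR_ge1Dx _); lra.
have h1 : 324 / 319 <= expR (1 / 64) :> R.
  by rewrite (_ : 1 / 64 = 1 / 128 + 1 / 128); [apply: sq h0 _ | field]; lra.
have h2 : 98 / 95 <= expR (1 / 32) :> R.
  by rewrite (_ : 1 / 32 = 1 / 64 + 1 / 64); [apply: sq h1 _ | field]; lra.
have h3 : 282 / 265 <= expR (1 / 16) :> R.
  by rewrite (_ : 1 / 16 = 1 / 32 + 1 / 32); [apply: sq h2 _ | field]; lra.
have h4 : 77 / 68 <= expR (1 / 8) :> R.
  by rewrite (_ : 1 / 8 = 1 / 16 + 1 / 16); [apply: sq h3 _ | field]; lra.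
have h5 : 259 / 202 <= expR (1 / 4) :> R.
  by rewrite (_ : 1 / 4 = 1 / 8 + 1 / 8); [apply: sq h4 _ | field]; lra.
have h6 : 120 / 73 <= expR (1 / 2) :> R.
  by rewrite (_ : 1 / 2 = 1 / 4 + 1 / 4); [apply: sq h5 _ | field]; lra.
by rewrite [X in expR X](_ : 1 = 1 / 2 + 1 / 2); [apply: sq h6 _ | field]; lra.
Qed.

(* [x := w / e] in [1 + (x - 1) <= expR (x - 1)] *)
Lemma ln_le_div_expR1 (R : realType) (w : R) : 0 < w -> ln w <= w / expR 1.
Proof.
move=> w0.
have := expR_ge1Dx (w / expR 1 - 1).
rewrite addrC subrK expRD expRN ler_pM2r ?invr_gt0 ?expR_gt0// => h.
by rewrite -ler_expR lnK// posrE.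
Qed.

(* For [k = 3], bounding the second term by [2 w / (2 w + 3)] leaves
   [w ^+ 3 * (2 w + 3) / 3 <= expR (3 w / 2)], which is split by
   [w ^+ 3 <= expR (3 w / e)]. *)
Lemma chi2_tail_sum_le1 (R : realType) (k w : R) : 3 <= k -> expR 1 <= w ->
  expR (- (k / 2 * (w - 2 * ln w))) + expR (- (k / (2 * w))) <= 1.
Proof.
move=> k3 ew; have e27 := expR1_ge_27_10 R.
have e0 : 0 < expR 1 :> R by exact: expR_gt0.
set e := expR 1 in ew e27 e0.
have w0 : 0 < w by lra.
have lnw := ln_le_div_expR1 w0; rewrite -/e in lnw.
have we : w / e * e = w by rewrite mulfVK// gt_eqF.
have we0 : 0 < w / e by rewrite divr_gt0.
set v := w / e in lnw we we0.
(* Here [ln w <= w / e] and [e > 2]. This sign makes the first exponential decreasing in [k], so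
   that [k = 3] is the worst case for both. *)
have lnw2 : 0 <= w - 2 * ln w by nra.
have h1 : expR (- (k / 2 * (w - 2 * ln w))) <= expR (- (3 / 2 * (w - 2 * ln w))).
  by rewrite ler_expR lerN2; nra.
have h2 : expR (- (k / (2 * w))) <= expR (- (3 / (2 * w))).
  by rewrite ler_expR lerN2 ler_pM2r// invr_gt0; lra.
apply: le_trans (lerD h1 h2) _.
have h3 : expR (- (3 / (2 * w))) <= 2 * w / (2 * w + 3).
  rewrite expRN -[leRHS]invrK lef_pV2 ?posrE ?expR_gt0//; last first.
    by rewrite invr_gt0 divr_gt0//; lra.
  apply: le_trans (expR_ge1Dx _).
  by rewrite le_eqVlt; apply/orP; left; apply/eqP; field; apply/andP; split; lra.
have h4 : expR (- (3 / 2 * (w - 2 * ln w))) <= 3 / (2 * w + 3).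
  rewrite expRN -[leRHS]invrK lef_pV2 ?posrE ?expR_gt0//; last first.
    by rewrite invr_gt0 divr_gt0//; lra.
  have -> : (3 / (2 * w + 3))^-1 = 2 / 3 * w + 1 by field; lra.
  have h5 : 3 / 2 * w - 3 * v <= 3 / 2 * (w - 2 * ln w) by lra.
  rewrite -ler_expR in h5; apply: le_trans h5.
  (* This is the tangent bound [e * y <= expR y] at [y = 3 / 2 * w - 3 * v]. It leaves
     [2 / 3 * w + 1 <= (3 / 2 * e - 3) * w], which follows from [w >= e >= 27 / 10] with little
     room, hence the sharp bound on [e]. *)
  have := expR_ge1Dx (3 / 2 * w - 3 * v - 1).
  rewrite expRD expRN -/e ler_pdivlMr// => h6.
  apply: le_trans h6.
  nra.
apply: le_trans (lerD h4 h3) _.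
by rewrite -mulrDl addrC divff//; lra.
Qed.

(** * Integrals against image laws, and products of independent variables *)

Import HBNNSimple.

(** Linearity carries the identity from indicators to simple functions, and monotone convergence
    carries it to every nonnegative [g]. The weight [H] can be a density or the product of the
    remaining independent factors; the constant [k] absorbs the mass of that weight. *)
Lemma ge0_integral_indic_ext (R : realType) (d1 d2 : measure_display)
    (T1 : measurableType d1) (T2 : measurableType d2)
    (mu : {measure set T1 -> \bar R}) (nu : {measure set T2 -> \bar R})
    (phi : T1 -> T2) (H : T1 -> R) (k : R) :
  measurable_fun [set: T1] phi -> measurable_fun [set: T1] H ->
  (forall x, 0 <= H x) -> 0 <= k ->
  (forall B, measurable B ->
    (\int[mu]_x (H x * \1_B (phi x))%:E = k%:E * nu B)%E) ->
  forall g : T2 -> R, measurable_fun [set: T2] g -> (forall y, 0 <= g y) ->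
    (\int[mu]_x (H x * g (phi x))%:E = k%:E * \int[nu]_y (g y)%:E)%E.
Proof.
move=> mphi mH H0 k0 indicE g mg g0.
have mEg : measurable_fun [set: T2] (EFin \o g) by exact/measurable_EFinP.
pose h := nnsfun_approx measurableT mEg.
have hg y : (h n y)%:E @[n --> \oo] --> (g y)%:E.
  exact: (@cvg_nnsfun_approx _ _ _ _ measurableT _ mEg (fun x _ => g0 x) y).
have mHh n : measurable_fun [set: T1] (fun x => (H x * h n (phi x))%:E).
  apply/measurable_EFinP; apply: measurable_funM => //.
  by apply: measurableT_comp => //; exact/measurable_funP.
have -> : (\int[nu]_y (g y)%:E)%E = limn (fun n => \int[nu]_y (h n y)%:E)%E.
  under eq_integral do rewrite -(cvg_lim (@ereal_hausdorff _) (hg _)).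
  apply: monotone_convergence => //.
  - by move=> n; apply/measurable_EFinP; exact/measurable_funP.
  - by move=> n y _; rewrite lee_fin.
  - by move=> y _ a b ab; rewrite lee_fin; exact/lefP/nd_nnsfun_approx.
have -> : (\int[mu]_x (H x * g (phi x))%:E)%E =
    limn (fun n => \int[mu]_x (H x * h n (phi x))%:E)%E.
  have Hg x : (H x * g (phi x))%:E = limn (fun n => (H x * h n (phi x))%:E).
    apply/esym/cvg_lim => //; under eq_fun do rewrite EFinM.
    by rewrite EFinM; apply: cvgeZl.
  under eq_integral do rewrite Hg.
  apply: monotone_convergence => //.
  - by move=> n x _; rewrite lee_fin mulr_ge0.
  - move=> x _ a b ab; rewrite lee_fin ler_wpM2l//.
    exact/lefP/nd_nnsfun_approx.
rewrite -limeMl//; last first.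
  have mh m : measurable_fun [set: T2] (fun y => (h m y)%:E).
    by apply/measurable_EFinP; exact/measurable_funP.
  apply: ereal_nondecreasing_is_cvgn => a b ab; apply: ge0_le_integral => //.
  - by move=> y _; rewrite lee_fin.
  - by move=> y _; rewrite lee_fin; exact/lefP/nd_nnsfun_approx.
apply: congr_lim; apply/funext => n.
(* A negative [y] is not a value of [h n], so its fibre is empty and the indicator vanishes. *)
have nn y z : 0 <= y * \1_(h n @^-1` [set y]) z.
  by have := nnfun_muleindic_ge0 (h n) y z; rewrite -EFinM lee_fin.
have mind y : measurable_fun [set: T2] (\1_(h n @^-1` [set y]) : T2 -> R).
  exact: measurable_indic.
pose s := finmap.enum_fset (fset_set (range (h n))).
have hE y : h n y = \sum_(z <- s) z * \1_(h n @^-1` [set z]) y.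
  by rewrite fimfunE fsbig_finite.
have -> : (\int[mu]_x (H x * h n (phi x))%:E =
    \sum_(z <- s) \int[mu]_x (z * (H x * \1_(h n @^-1` [set z]) (phi x)))%:E)%E.
  rewrite -ge0_integral_sum//.
  - apply: eq_integral => x _; rewrite sumEFin hE mulr_sumr; congr EFin.
    by apply: eq_bigr => z _; rewrite mulrCA.
  - move=> z; apply/measurable_EFinP; apply: measurable_funM => //.
    apply: measurable_funM => //.
    exact: (measurableT_comp (mind z)).
  - by move=> z x _; rewrite lee_fin mulrCA mulr_ge0.
have -> : (\int[nu]_y (h n y)%:E =
    \sum_(z <- s) \int[nu]_y (z * \1_(h n @^-1` [set z]) y)%:E)%E.
  rewrite -ge0_integral_sum//.
  - by apply: eq_integral => x _; rewrite sumEFin hE.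
  - by move=> z; apply/measurable_EFinP; apply: measurable_funM.
  - by move=> z x _; rewrite lee_fin.
rewrite ge0_sume_distrr; last first.
  by move=> z _; apply: integral_ge0 => y _; rewrite lee_fin.
rewrite big_seq [RHS]big_seq; apply: eq_bigr => z zs.
have z0 : 0 <= z.
  by move: zs; rewrite /s in_fset_set// inE => -[y _ <-].
under eq_integral do rewrite EFinM.
under [in RHS]eq_integral do rewrite EFinM.
rewrite !ge0_integralZl_EFin//.
- by rewrite indicE// [in RHS]integral_indic// setIT muleCA.
- exact/measurable_EFinP.
- by move=> x _; rewrite lee_fin mulr_ge0.
- apply/measurable_EFinP; apply: measurable_funM => //.
  exact: (measurableT_comp (mind z)).
Qed.

(** Independence is the case where all factors are indicators. The indicators are then exchanged for
    the functions [g i] one index at a time, each exchange being an instance of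
    [ge0_integral_indic_ext]. *)
Lemma ge0_integral_prod_independent (R : realType) (d d' : measure_display)
    (T : measurableType d) (E : measurableType d') (mu : probability T R)
    (K : nat) (X : 'I_K -> T -> E) (nu : 'I_K -> probability E R)
    (g : 'I_K -> E -> R) (c : 'I_K -> R) :
  (forall i, measurable_fun [set: T] (X i)) ->
  (forall B : 'I_K -> set E, (forall i, measurable (B i)) ->
    mu (\bigcap_i (X i @^-1` B i)) = (\prod_(i < K) nu i (B i))%E) ->
  (forall i, measurable_fun [set: E] (g i)) -> (forall i y, 0 <= g i y) ->
  (forall i, (\int[nu i]_y (g i y)%:E)%E = (c i)%:E) ->
  (\int[mu]_x (\prod_(i < K) g i (X i x))%:E)%E = (\prod_(i < K) c i)%:E.
Proof.
move=> mX indep mg g0 gc.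
have c0 i : 0 <= c i.
  by rewrite -lee_fin -gc; apply: integral_ge0 => y _; rewrite lee_fin.
(* Hybrid family: the indices below [n] already carry [g], the others still carry indicators. The
   sets [B] stay universally quantified in the induction, since the step changes the set at index
   [n]. *)
pose F n (B : 'I_K -> set E) (i : 'I_K) : E -> R :=
  if (i < n)%N then g i else \1_(B i).
pose p n (B : 'I_K -> set E) (i : 'I_K) : R :=
  if (i < n)%N then c i else fine (nu i (B i)).
have F0 n B i y : 0 <= F n B i y by rewrite /F; case: ifP => // _; exact: g0.
have p0 n B i : 0 <= p n B i.
  by rewrite /p; case: ifP => // _; rewrite fine_ge0.
have mF n B i : (forall j, measurable (B j)) ->
    measurable_fun [set: T] (fun x => F n B i (X i x)).
  move=> mB; rewrite /F; case: ifP => _; first exact: measurableT_comp.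
  by apply: (@measurableT_comp _ _ _ _ _ _ (\1_(B i) : E -> R)) => //;
     exact: measurable_indic.
suff main n : (n <= K)%N -> forall B : 'I_K -> set E,
    (forall i, measurable (B i)) ->
    (\int[mu]_x (\prod_(i < K) F n B i (X i x))%:E)%E = (\prod_(i < K) p n B i)%:E.
  have := main K (leqnn K) (fun=> setT) (fun=> measurableT).
  under eq_integral do under eq_bigr do rewrite /F ltn_ord.
  by under [in RHS]eq_bigr do rewrite /p ltn_ord.
elim: n => [_|n IH nK] B mB.
  transitivity (mu (\bigcap_i (X i @^-1` B i))).
    rewrite -[in RHS](setIT (\bigcap_i _)) -integral_indic//; last first.
      apply: fin_bigcap_measurable => // i _.
      by rewrite -[X in measurable X]setTI; exact: mX.
    apply: eq_integral => x _; congr EFin.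
    rewrite indicE; case: (boolP (x \in _)) => [|] xB.
      rewrite big1// => i _; rewrite /F ltn0 indicE mem_set//.
      by move: xB; rewrite inE => /(_ i I).
    have [i Bi] : exists i, ~ B i (X i x).
      apply: contrapT => h; move/negP: xB; apply; rewrite inE => i _ /=.
      by apply: contrapT => ?; apply: h; exists i.
    by rewrite (bigD1 i)//= /F ltn0 indicE memNset// mul0r.
  rewrite indep// -prodEFin; apply: eq_bigr => i _.
  by rewrite /p ltn0 fineK// fin_num_measure.
pose i0 := Ordinal nK.
have Flt i B' : i != i0 -> F n.+1 B i = F n (fun j => if j == i0 then B' else B j) i.
  move=> ii0; rewrite /F ltnS leq_eqVlt (negbTE ii0).
  by rewrite (_ : (i == n :> nat) = false)//; exact: negbTE.
have plt i B' : i != i0 -> p n.+1 B i = p n (fun j => if j == i0 then B' else B j) i.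
  move=> ii0; rewrite /p ltnS leq_eqVlt (negbTE ii0).
  by rewrite (_ : (i == n :> nat) = false)//; exact: negbTE.
rewrite (bigD1 i0)//= {1}/p ltnSn EFinM -gc muleC.
transitivity (\int[mu]_x ((\prod_(i < K | i != i0) F n.+1 B i (X i x)) * g i0 (X i0 x))%:E)%E.
  by apply: eq_integral => x _; rewrite (bigD1 i0)//= {1}/F ltnSn mulrC.
(* The factors other than [i0] form the weight [H]. With an indicator of [B'] in place of [g i0],
   the integral is the hybrid of level [n] whose set at [i0] is [B']. *)
apply: ge0_integral_indic_ext => //.
- under eq_fun do rewrite big_mkcond.
  by apply: measurable_prod => i _; case: (i != i0); [exact: mF|exact: measurable_cst].
- by move=> x; apply: prodr_ge0 => i _.
- by apply: prodr_ge0 => i _.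
move=> B' mB'.
have {}IH := IH (ltnW nK) (fun j => if j == i0 then B' else B j).
transitivity (\int[mu]_x (\prod_(i < K) F n (fun j => if j == i0 then B' else B j) i (X i x))%:E)%E.
  apply: eq_integral => x _; rewrite [in RHS](bigD1 i0)//= {2}/F ltnn eqxx mulrC.
  by congr (_ * _)%:E; apply: eq_bigr => i ii0; rewrite (Flt _ B').
rewrite IH; last by move=> i; case: ifP.
rewrite (bigD1 i0)//= EFinM {1}/p ltnn eqxx fineK ?fin_num_measure// muleC.
by congr (_%:E * _)%E; apply: eq_bigr => i ii0; rewrite (plt _ B').
Qed.

Lemma ge0_integral_law (R : realType) (d d' : measure_display)
    (T : measurableType d) (E : measurableType d') (Pr : probability T R)
    (X : T -> E) (nu : probability E R) (g : E -> R) :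
  measurable_fun [set: T] X ->
  (forall B : set E, measurable B -> Pr (X @^-1` B) = nu B) ->
  measurable_fun [set: E] g -> (forall y, 0 <= g y) ->
  (\int[Pr]_x (g (X x))%:E = \int[nu]_y (g y)%:E)%E.
Proof.
move=> mX lawX mg g0; rewrite -[RHS]mul1e.
rewrite -(@ge0_integral_indic_ext _ _ _ _ _ Pr _ X (cst 1))//.
  by apply: eq_integral => x _; rewrite mul1r.
move=> B mB; under eq_integral do rewrite mul1r.
have mXB : measurable (X @^-1` B).
  by rewrite -[X in measurable X]setTI; exact: mX.
rewrite mul1e; transitivity (Pr (X @^-1` B)); last exact: lawX.
by rewrite -[X in Pr X]setIT -integral_indic.
Qed.

(** * Exponential moments of the normal law *)

Lemma ge0_integral_normal_prob (R : realType) (m s : R) (g : R -> R) :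
  measurable_fun [set: R] g -> (forall y, 0 <= g y) ->
  (\int[normal_prob m s]_x (g x)%:E =
   \int[lebesgue_measure]_x (normal_pdf m s x * g x)%:E)%E.
Proof.
move=> mg g0; rewrite -[LHS]mul1e.
rewrite -(@ge0_integral_indic_ext _ _ _ _ _ lebesgue_measure _ id (normal_pdf m s))//.
- exact: measurable_normal_pdf.
- by move=> x; exact: normal_pdf_ge0.
move=> B mB; rewrite mul1e [RHS]integral_mkcond.
by apply: eq_integral => x _; rewrite epatch_indic EFinM.
Qed.

(* Completing the square: tilting by [expR (t * x)] shifts the mean to [m + s ^+ 2 * t]. *)
Lemma integral_normal_expR_linear (R : realType) (m s t : R) : s != 0 ->
  (\int[normal_prob m s]_x (expR (t * x))%:E =
   (expR (m * t + s ^+ 2 * t ^+ 2 / 2))%:E)%E.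
Proof.
move=> s0; rewrite ge0_integral_normal_prob; last 2 first.
- by apply: measurableT_comp => //; exact: measurable_funM.
- by move=> y; exact: expR_ge0.
transitivity (\int[lebesgue_measure]_x ((expR (m * t + s ^+ 2 * t ^+ 2 / 2))%:E *
    (normal_pdf (m + s ^+ 2 * t) s x)%:E))%E.
  apply: eq_integral => x _; rewrite -EFinM; congr EFin.
  rewrite !normal_pdfE//= -[LHS]mulrA [RHS]mulrCA; congr (_ * _).
  rewrite /normal_fun -!expRD; congr expR.
  by field.
rewrite ge0_integralZl//.
- by rewrite integral_normal_pdf mule1.
- by apply/measurable_EFinP; exact: measurable_normal_pdf.
- by move=> x _; rewrite lee_fin normal_pdf_ge0.
Qed.

(* Tilting by a centered Gaussian weight rescales the standard deviation to [s * tau]. *)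
Lemma integral_normal_expR_sqr (R : realType) (s tau : R) : s != 0 -> 0 < tau ->
  (\int[normal_prob 0 s]_x
     (expR ((1 - tau ^- 2) / (2 * s ^+ 2) * x ^+ 2))%:E = tau%:E)%E.
Proof.
move=> s0 tau0; rewrite ge0_integral_normal_prob; last 2 first.
- by apply: measurableT_comp => //; exact: measurable_funM.
- by move=> y; exact: expR_ge0.
have st0 : s * tau != 0 by rewrite mulf_neq0// gt_eqF.
transitivity (\int[lebesgue_measure]_x (tau%:E * (normal_pdf 0 (s * tau) x)%:E))%E.
  apply: eq_integral => x _; rewrite -EFinM; congr EFin.
  rewrite !normal_pdfE//= /normal_peak.
  have -> : (s * tau) ^+ 2 * pi *+ 2 = tau ^+ 2 * (s ^+ 2 * pi *+ 2) :> R.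
    by rewrite exprMn; ring.
  rewrite sqrtrM ?sqr_ge0// sqrtr_sqr gtr0_norm// [in RHS]invfM.
  rewrite -[in RHS](mulrA tau^-1) -[LHS]mulrA [RHS]mulrA divff ?gt_eqF// mul1r.
  congr (_ * _).
  rewrite /normal_fun -!expRD; congr expR.
  by field; rewrite s0 gt_eqF.
rewrite ge0_integralZl//.
- by rewrite integral_normal_pdf mule1.
- by apply/measurable_EFinP; exact: measurable_normal_pdf.
- by move=> x _; rewrite lee_fin normal_pdf_ge0.
- by rewrite lee_fin ltW.
Qed.

(** * Chernoff bounds for sums of squares of independent normal variables *)

Lemma measurable_set_ler (R : realType) (d : measure_display)
    (T : measurableType d) (f g : T -> R) :
  measurable_fun [set: T] f -> measurable_fun [set: T] g ->
  measurable [set x | f x <= g x].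
Proof.
move=> mf mg; rewrite -[X in measurable X]setTI.
have : measurable [set true] by [].
exact: (measurable_fun_ler mf mg).
Qed.

(* [theta] is chosen so that [expR (theta * X i ^+ 2)] has mean [expR a]. *)
Lemma normal_sum_sqr_chernoff (R : realType) (d : measure_display)
    (T : measurableType d) (Pr : probability T R) (K : nat)
    (X : 'I_K -> T -> R) (s a c : R) (theta : R := (1 - expR (- (2 * a))) / (2 * s ^+ 2)) :
  s != 0 -> (forall i, measurable_fun [set: T] (X i)) ->
  (forall B : 'I_K -> set R, (forall i, measurable (B i)) ->
    Pr (\bigcap_i (X i @^-1` B i)) = (\prod_(i < K) normal_prob 0 s (B i))%E) ->
  (Pr [set x | c <= theta * \sum_(i < K) X i x ^+ 2]%R <= (expR (K%:R * a - c))%:E)%E.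
Proof.
move=> s0 mX indep.
have mS : measurable_fun [set: T] (fun x => theta * \sum_(i < K) X i x ^+ 2).
  apply: measurable_funM => //; apply: measurable_sum => i.
  exact: measurable_funX.
have mA : measurable [set x | c <= theta * \sum_(i < K) X i x ^+ 2].
  exact: measurable_set_ler.
set A := [set x | _] in mA *.
have mgf : (\int[Pr]_x (expR (theta * \sum_(i < K) X i x ^+ 2))%:E = (expR (K%:R * a))%:E)%E.
  transitivity (\int[Pr]_x (\prod_(i < K) expR (theta * X i x ^+ 2))%:E)%E.
    by apply: eq_integral => x _; rewrite mulr_sumr expR_sum.
  rewrite (@ge0_integral_prod_independent R _ _ T (measurableTypeR R) Pr K X
    (fun=> normal_prob 0 s)
    (fun=> fun y => expR (theta * y ^+ 2)) (fun=> expR a))//.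
  - by rewrite prodr_const card_ord expRM_natl.
  - by move=> _; apply: measurableT_comp => //; exact: measurable_funM.
  - move=> _; rewrite -(integral_normal_expR_sqr s0 (expR_gt0 a)).
    by rewrite /theta -expRM_natl -expRN mulr2n.
(* Markov's inequality: [expR c] times the indicator of [A] is at most the exponential whose
   integral is [mgf]. *)
rewrite expRD expRN EFinM lee_pdivlMr ?expR_gt0// -mgf.
have -> : Pr A = (\int[Pr]_x (\1_A x)%:E)%E by rewrite integral_indic// setIT.
rewrite -ge0_integralZr ?lee_fin ?expR_ge0//; last exact/measurable_EFinP.
apply: ge0_le_integral => //.
- by apply/measurable_EFinP/measurable_funM => //; exact: measurable_indic.
- by apply/measurable_EFinP; exact: measurableT_comp.
move=> x _; rewrite -EFinM lee_fin indicE.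
case: (boolP (x \in A)) => [|_]; last by rewrite mul0r expR_ge0.
by rewrite inE /A /= mul1r ler_expR.
Qed.

(** Each tail gets its own Chernoff bound. Both bounds contain the factor [(e / w)^(K / 2)], and the
    two cofactors add up to at most 1 by [chi2_tail_sum_le1], so no factor 2 is lost. *)
Lemma normal_sum_sqr_two_sided (R : realType) (d : measure_display)
    (T : measurableType d) (Pr : probability T R) (K : nat)
    (X : 'I_K -> T -> R) (s w : R) :
  s != 0 -> (3 <= K)%N -> expR 1 <= w ->
  (forall i, measurable_fun [set: T] (X i)) ->
  (forall B : 'I_K -> set R, (forall i, measurable (B i)) ->
    Pr (\bigcap_i (X i @^-1` B i)) = (\prod_(i < K) normal_prob 0 s (B i))%E) ->
  (Pr [set x | ~~ (w^-1 * s ^+ 2 <= K%:R^-1 * \sum_(i < K) X i x ^+ 2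
                   <= w * s ^+ 2)]%R
   <= (expR (- (K%:R / 2 * (ln w - 1))))%:E)%E.
Proof.
move=> s0 K3 ew mX indep.
have w0 : 0 < w by apply: lt_le_trans ew; exact: expR_gt0.
have s2 : 0 < s ^+ 2 by rewrite exprn_even_gt0.
have K0 : 0 < K%:R :> R by rewrite ltr0n (leq_trans _ K3).
have KR3 : 3 <= K%:R :> R by rewrite ler_nat.
have w1 : 1 <= w by apply: le_trans ew; have := @expR_ge1Dx R 1; lra.
set k : R := K%:R in K0 KR3 *.
pose U a c := [set x | c <= (1 - expR (- (2 * a))) / (2 * s ^+ 2) *
                         \sum_(i < K) X i x ^+ 2].
have mS : measurable_fun [set: T] (fun x => \sum_(i < K) X i x ^+ 2).
  by apply: measurable_sum => i; exact: measurable_funX.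
have mU a c : measurable (U a c).
  by apply: measurable_set_ler => //; exact: measurable_funM.
have elnw : expR (- ln w) = w^-1 by rewrite expRN lnK.
(* The optimal tilts are [expR (- (2 * a)) = w^-1] for the upper tail and [w] for the lower one. The
   thresholds are [theta] times [k * w * s ^+ 2], resp. [k * w^-1 * s ^+ 2]. In the lower tail
   [theta] is at most 0, which reverses the inequality on the sum. *)
pose U1 := U (ln w / 2) (k * (w - 1) / 2).
pose U2 := U (- (ln w / 2)) (k * (1 - w) / (2 * w)).
have sub : [set x | ~~ (w^-1 * s ^+ 2 <= k^-1 * \sum_(i < K) X i x ^+ 2
    <= w * s ^+ 2)] `<=` U1 `|` U2.
  move=> x /=; rewrite negb_and -!ltNge => /orP[h|h].
    right; rewrite /U2 /U /=.
    have -> : - (2 * - (ln w / 2)) = ln w by field.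
    rewrite lnK//.
    have h' : \sum_(i < K) X i x ^+ 2 <= k * (w^-1 * s ^+ 2).
      by rewrite ltW// -ltr_pdivrMl.
    have -> : k * (1 - w) / (2 * w) = (1 - w) / (2 * s ^+ 2) * (k * (w^-1 * s ^+ 2)).
      by field; rewrite ?s0 ?(gt_eqF w0).
    rewrite ler_wnM2l//.
    by rewrite mulr_le0_ge0 ?subr_le0// invr_ge0 mulr_ge0// ltW.
  left; rewrite /U1 /U /=.
  have -> : - (2 * (ln w / 2)) = - ln w by field.
  rewrite elnw.
  have h' : k * (w * s ^+ 2) <= \sum_(i < K) X i x ^+ 2.
    by rewrite ltW// -ltr_pdivlMl.
  have -> : k * (w - 1) / 2 = (1 - w^-1) / (2 * s ^+ 2) * (k * (w * s ^+ 2)).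
    by field; rewrite ?s0 ?(gt_eqF w0).
  by rewrite ler_wpM2l// divr_ge0 ?subr_ge0 ?invf_le1// mulr_ge0// ltW.
have mC : measurable [set x | ~~ (w^-1 * s ^+ 2 <= k^-1 * \sum_(i < K) X i x ^+ 2
    <= w * s ^+ 2)].
  rewrite (_ : [set x | _] = ~` ([set x | w^-1 * s ^+ 2 <= k^-1 * \sum_(i < K) X i x ^+ 2]
     `&` [set x | k^-1 * \sum_(i < K) X i x ^+ 2 <= w * s ^+ 2])); last first.
    by apply/seteqP; split=> x /=; [move/negP => h [a b]; apply: h; rewrite a
      |move=> h; apply/negP => /andP].
  apply: measurableC; apply: measurableI; apply: measurable_set_ler => //;
    exact: measurable_funM.
apply: (@le_trans _ _ (Pr (U1 `|` U2))).
  by apply: le_measure => //; rewrite ?inE//; apply: measurableU; exact: mU.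
apply: (le_trans (measureU2 _ (mU _ _) (mU _ _))).
apply: (le_trans (leeD (normal_sum_sqr_chernoff _ _ s0 mX indep)
   (normal_sum_sqr_chernoff _ _ s0 mX indep))).
rewrite -EFinD lee_fin -/k.
have -> : k * (ln w / 2) - k * (w - 1) / 2 =
    - (k / 2 * (ln w - 1)) - (k / 2 * (w - 2 * ln w)) by field.
have -> : k * - (ln w / 2) - k * (1 - w) / (2 * w) =
    - (k / 2 * (ln w - 1)) - (k / (2 * w)) by field; lra.
rewrite !expRD -mulrDr ler_piMr ?expR_ge0//.
exact: chi2_tail_sum_le1.
Qed.

(** * The law of a linear functional of a Gaussian vector *)

Lemma dotvE (R : realType) (N : nat) (v x : 'cV[R]_N) :
  dotv v x = \sum_(j < N) v j 0 * x j 0.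
Proof. by rewrite /dotv mxE; apply: eq_bigr => j _; rewrite mxE. Qed.

Lemma measurable_coord (R : realType) (N : nat) (j : 'I_N) :
  measurable_fun [set: borelcV R N] (fun z : borelcV R N => (z : 'cV[R]_N) j 0).
Proof.
move=> mD; apply: (measurability _ (RGenOInfty.measurableE R)) => //.
move=> /= _ [_ [a ->] <-]; rewrite setTI; apply: sub_sigma_algebra => /=.
apply: (@open_comp _ _ (fun z : 'cV[R]_N => z j 0)); last exact: interval_open.
by move=> z _; exact: coord_continuous.
Qed.

Lemma measurable_dotv (R : realType) (N : nat) (d : measure_display)
    (T : measurableType d) (Z : T -> 'cV[R]_N) (v : 'cV[R]_N) :
  (forall j, measurable_fun [set: T] (fun x => Z x j 0)) ->
  measurable_fun [set: T] (fun x => dotv v (Z x)).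
Proof.
move=> mZ; under eq_fun do rewrite dotvE.
by apply: measurable_sum => j; exact: measurable_funM.
Qed.

(** A difference of extended reals is finite only if both terms are, so the integrals of the
    positive and negative parts are finite. This recovers integrability from the mere values of
    means and covariances. *)
Lemma fin_num_integrable (R : realType) (d : measure_display)
    (T : measurableType d) (mu : {measure set T -> \bar R}) (f : T -> \bar R) :
  measurable_fun [set: T] f -> (\int[mu]_x f x)%E \is a fin_num ->
  mu.-integrable [set: T] f.
Proof.
move=> mf; rewrite integralE fin_numB => /andP[fp fn].
apply/integrableP; split => //.
rewrite -[X in (\int[mu]_(x in _) X x)%E]/(abse \o f) fune_abse.
rewrite ge0_integralD//; [|exact: measurable_funepos|exact: measurable_funeneg].
by rewrite ltey_eq fin_numD fp fn.
Qed.

Lemma integral_lincomb (R : realType) (d : measure_display)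
    (T : measurableType d) (mu : {measure set T -> \bar R}) (I : finType)
    (F : I -> T -> R) (c e : I -> R) :
  (forall i, measurable_fun [set: T] (F i)) ->
  (forall i, (\int[mu]_x (F i x)%:E = (e i)%:E)%E) ->
  mu.-integrable [set: T] (fun x => (\sum_i c i * F i x)%:E) /\
  (\int[mu]_x (\sum_i c i * F i x)%:E = (\sum_i c i * e i)%:E)%E.
Proof.
move=> mF Fe.
have iF i : mu.-integrable [set: T] (EFin \o F i).
  apply: fin_num_integrable; first exact/measurable_EFinP.
  by rewrite Fe.
have icF i : mu.-integrable [set: T] (fun x => (c i)%:E * (F i x)%:E)%E.
  exact: (integrableZl measurableT (c i) (iF i)).
under eq_fun do rewrite -sumEFin.
split; first by apply: integrable_sum => // i _; exact: icF.
rewrite integral_sum// -sumEFin; apply: eq_bigr => i _.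
by rewrite [RHS]EFinM -Fe -(integralZl measurableT (iF i)).
Qed.

(* [1 + x <= expR x] turns the closed forms of the exponential moments into
   inequalities that hold with equality at [t = 0], resp. [tau = 1]; this pins
   down the first two moments. *)
Lemma normal_law_moments (R : realType) (d : measure_display)
    (T : measurableType d) (Pr : probability T R) (X : T -> R) (m s q : R) :
  measurable_fun [set: T] X ->
  (forall B : set R, measurable B -> Pr (X @^-1` B) = normal_law m s B) ->
  (\int[Pr]_x (X x)%:E = 0)%E -> (\int[Pr]_x (X x ^+ 2)%:E = q%:E)%E ->
  m = 0 /\ s ^+ 2 = q.
Proof.
move=> mX lawX EX EX2.
have expR_mean (Y : T -> R) (b e t : R) : measurable_fun [set: T] Y ->
    (\int[Pr]_x (Y x)%:E = b%:E)%E -> (\int[Pr]_x (expR (t * Y x))%:E = e%:E)%E ->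
    1 + t * b <= e.
  move=> mY Yb Ye.
  have iY : Pr.-integrable [set: T] (EFin \o Y).
    by apply: fin_num_integrable; [exact/measurable_EFinP|rewrite Yb].
  have itY : Pr.-integrable [set: T] (fun x => t%:E * (Y x)%:E)%E.
    exact: (integrableZl measurableT t iY).
  have i1 : Pr.-integrable [set: T] (cst 1%E).
    exact: finite_measure_integrable_cst.
  rewrite -lee_fin -Ye EFinD EFinM -Yb -integralZl//.
  have <- : (\int[Pr]_x cst 1%E x)%E = 1%:E.
    by rewrite integral_cst//= probability_setT mule1.
  rewrite -integralD//; apply: le_integral => //.
  - exact: integrableD.
  - apply: fin_num_integrable; last by rewrite Ye.
    apply/measurable_EFinP; apply: measurableT_comp => //.
    exact: measurable_funM.
  - by move=> x _; rewrite -EFinM -EFinD lee_fin expR_ge1Dx.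
have linexp t : (\int[Pr]_x (expR (t * X x))%:E =
    (expR (m * t + s ^+ 2 * t ^+ 2 / 2))%:E)%E.
  have mt : measurable_fun [set: R] (fun y : R => expR (t * y)).
    by apply: measurableT_comp => //; exact: measurable_funM.
  have [s0|s0] := eqVneq s 0.
    rewrite (@ge0_integral_law R _ _ T (measurableTypeR R) Pr X
      (@dirac _ (measurableTypeR R) m R) (fun y => expR (t * y)))//.
    - rewrite integral_dirac//; last exact/measurable_EFinP.
      by rewrite diracT mul1e s0 expr0n/= !mul0r addr0 mulrC.
    - by move=> B mB; rewrite lawX// /normal_law s0 eqxx.
  rewrite (@ge0_integral_law R _ _ T (measurableTypeR R) Pr X
    (normal_prob m s) (fun y => expR (t * y)))//.
  - exact: integral_normal_expR_linear.
  - by move=> B mB; rewrite lawX// /normal_law (negbTE s0).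
have m0 : m = 0.
  have [s0|s0] := eqVneq s 0.
    have := expR_mean X 0 _ (- m) mX EX (linexp _).
    rewrite mulr0 addr0 s0 expr0n/= !mul0r addr0 -[leLHS]expR0 ler_expR mulrN.
    by rewrite oppr_ge0 -expr2 => /(conj (sqr_ge0 m))/andP/le_anti/esym/eqP;
       rewrite sqrf_eq0 => /eqP.
  have s20 : 0 < s ^+ 2 by rewrite exprn_even_gt0.
  (* This [t] minimises the exponent [m * t + s ^+ 2 * t ^+ 2 / 2]. The minimum
     [- (m ^+ 2 / (2 * s ^+ 2))] has to be nonnegative because the mean of [X] is 0. *)
  have := expR_mean X 0 _ (- m / s ^+ 2) mX EX (linexp _).
  rewrite mulr0 addr0 -[leLHS]expR0 ler_expR.
  have -> : m * (- m / s ^+ 2) + s ^+ 2 * (- m / s ^+ 2) ^+ 2 / 2 = - (m ^+ 2 / (2 * s ^+ 2)).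
    by field.
  have s2V : 0 < (2 * s ^+ 2)^-1 by rewrite invr_gt0 (mulr_gt0 _ s20).
  rewrite oppr_ge0 (pmulr_lle0 _ s2V).
  by rewrite le_eqVlt ltNge sqr_ge0 orbF sqrf_eq0 => /eqP.
split=> //.
have [s0|s0] := eqVneq s 0.
  have m2 : measurable_fun [set: R] (fun y : R => y ^+ 2) by exact: exprn_measurable.
  apply: EFin_inj; rewrite -EX2 s0 expr0n/=.
  rewrite (@ge0_integral_law R _ _ T (measurableTypeR R) Pr X
    (@dirac _ (measurableTypeR R) m R) (fun y => y ^+ 2))//.
  - rewrite integral_dirac//; first by rewrite diracT mul1e m0 expr0n.
    exact/measurable_EFinP.
  - by move=> B mB; rewrite lawX// /normal_law s0 eqxx.
  - by move=> y; exact: sqr_ge0.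
have s20 : 0 < s ^+ 2 by rewrite exprn_even_gt0.
have bound tau : 0 < tau -> 1 + (1 - tau ^- 2) / (2 * s ^+ 2) * q <= tau.
  move=> tau0; apply: (expR_mean (fun x => X x ^+ 2)) => //.
    exact: measurable_funX.
  have mt : measurable_fun [set: R]
      (fun y : R => expR ((1 - tau ^- 2) / (2 * s ^+ 2) * y ^+ 2)).
    by apply: measurableT_comp => //; exact: measurable_funM.
  rewrite (@ge0_integral_law R _ _ T (measurableTypeR R) Pr X (normal_prob 0 s)
    (fun y => expR ((1 - tau ^- 2) / (2 * s ^+ 2) * y ^+ 2)))//.
  - exact: integral_normal_expR_sqr.
  - by move=> B mB; rewrite lawX// /normal_law m0 (negbTE s0).
have q0 : 0 <= q.
  by rewrite -lee_fin -EX2; apply: integral_ge0 => x _; rewrite lee_fin sqr_ge0.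
pose c := q / s ^+ 2.
have c0 : 0 <= c by rewrite divr_ge0// ltW.
have qE : q = c * s ^+ 2 by rewrite mulfVK// gt_eqF.
(* Both sides keep the factor [tau - 1], so values of [tau] below and above 1 give opposite bounds
   on [c], which meet at [c = 1]. *)
have boundc tau : 0 < tau -> (tau - 1) * ((tau + 1) * c) <= (tau - 1) * (2 * tau ^+ 2).
  move=> tau0; have := bound _ tau0.
  have -> : 1 + (1 - tau ^- 2) / (2 * s ^+ 2) * q
          = 1 + (tau - 1) * ((tau + 1) * c) / (2 * tau ^+ 2).
    by rewrite qE; field; rewrite ?s0 ?(gt_eqF tau0).
  rewrite addrC -lerBrDr ler_pdivrMr//.
  by rewrite mulr_gt0// exprn_gt0.
suff c1 : c = 1 by rewrite qE c1 mul1r.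
have [c1|c1|//] := ltgtP c 1.
(* For the arithmetic mean [tau] of 1 and [c], one has [(tau + 1) * c = 2 * tau ^+ 2 + tau - 1],
   which is less than [2 * tau ^+ 2] since [tau < 1]. *)
- have := boundc ((1 + c) / 2); nra.
- have d0 : 0 < 1 + c by lra.
  (* The harmonic mean of 1 and [c] lies above 1, yet its square is below the squared geometric mean
     [c]. This contradicts [c <= tau ^+ 2]. *)
  set tau := 2 * c / (1 + c).
  have tauE : tau * (1 + c) = 2 * c by rewrite mulfVK// gt_eqF.
  have tau1 : 1 < tau by rewrite /tau ltr_pdivlMr//; lra.
  have := boundc tau; rewrite ler_pM2l ?subr_gt0// => h.
  have {}h : (tau + 1) * c <= 2 * tau ^+ 2 by apply: h; lra.
  have : c <= tau ^+ 2 by nra.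
  nra.
Qed.

(** The moments determine [s ^+ 2] only, so the sign of [s] has to be immaterial to the law. *)
Lemma normal_law_norm (R : realType) (m s : R) (B : set R) :
  normal_law m `|s| B = normal_law m s B.
Proof.
rewrite /normal_law normr_eq0; case: ifPn => // s0.
rewrite /normal_prob; apply: eq_integral => x _.
by rewrite !normal_pdfE ?normr_eq0//= /normal_peak /normal_fun real_normK ?num_real.
Qed.

(** [gaussian_vector] supplies some [m] and [s] for each [v]. The mean and covariance of [Z] give
    the first two moments of [dotv v Z] by linearity, and [normal_law_moments] then identifies [m]
    as 0 and [s ^+ 2] as the quadratic form of [Sigma] at [v]. *)
Lemma gaussian_dotv_law (R : realType) (N : nat) (d : measure_display)
    (T : measurableType d) (Pr : probability T R) (Z : T -> 'cV[R]_N)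
    (Sigma : 'M[R]_N) (v : 'cV[R]_N) (B : set R) :
  (forall j, measurable_fun [set: T] (fun x => Z x j 0)) ->
  gaussian_vector Pr Z -> has_mean Pr Z 0 -> has_covariance Pr Z Sigma ->
  measurable B ->
  Pr [set x | B (dotv v (Z x))] = normal_law 0 (normS Sigma v) B.
Proof.
move=> mZ gaussZ meanZ covZ mB.
have EZ j : (\int[Pr]_x (Z x j 0)%:E = 0%:E)%E.
  by have := meanZ j; rewrite unlock mxE.
have EZZ j k : (\int[Pr]_x (Z x j 0 * Z x k 0)%:E = (Sigma j k)%:E)%E.
  rewrite -covZ covariance.unlock !meanZ !mxE/= expectation.unlock.
  apply: eq_integral => x _.
  by rewrite -[RHS]/(((Z x j 0 - 0) * (Z x k 0 - 0))%:E) !subr0.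
have [m [s lawv]] := gaussZ v.
have EX : (\int[Pr]_x (dotv v (Z x))%:E = 0)%E.
  have [_] := integral_lincomb (fun j => v j 0) mZ EZ.
  under eq_integral do rewrite -dotvE.
  by move=> ->; rewrite big1// => j _; rewrite mulr0.
have EX2 : (\int[Pr]_x (dotv v (Z x) ^+ 2)%:E = (dotv v (Sigma *m v))%:E)%E.
  have mZZ (p : 'I_N * 'I_N) : measurable_fun [set: T] (fun x => Z x p.1 0 * Z x p.2 0).
    exact: measurable_funM.
  have [_ h] := integral_lincomb (fun p => v p.1 0 * v p.2 0) mZZ (fun p => EZZ p.1 p.2).
  have -> : dotv v (Sigma *m v) = \sum_(p : 'I_N * 'I_N) v p.1 0 * v p.2 0 * Sigma p.1 p.2.
    rewrite -(pair_bigA _ (fun j k => v j 0 * v k 0 * Sigma j k))/= dotvE.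
    apply: eq_bigr => j _; rewrite mxE mulr_sumr.
    by apply: eq_bigr => k _; ring.
  rewrite -h; apply: eq_integral => x _; congr EFin.
  rewrite -(pair_bigA _ (fun j k => v j 0 * v k 0 * (Z x j 0 * Z x k 0)))/= dotvE.
  rewrite expr2 mulr_suml; apply: eq_bigr => j _; rewrite mulr_sumr.
  by apply: eq_bigr => k _; ring.
have [m0 s2] := normal_law_moments (measurable_dotv v mZ) lawv EX EX2.
by rewrite lawv// m0 /normS -s2 sqrtr_sqr normal_law_norm.
Qed.

Lemma sample_norm_two_sided (R : realType) (N K : nat) (d : measure_display)
    (T : measurableType d) (Pr : probability T R)
    (Z : 'I_K -> {RV Pr >-> borelcV R N}) (Sigma : 'M[R]_N) (v : 'cV[R]_N) (w : R) :
  (forall i, gaussian_vector Pr (Z i)) -> (forall i, has_mean Pr (Z i) 0) ->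
  (forall i, has_covariance Pr (Z i) Sigma) -> independent_vectors Pr Z ->
  (3 <= K)%N -> expR 1 <= w ->
  (Pr [set x | ~~ (w^-1 * normS Sigma v ^+ 2
                   <= K%:R^-1 * \sum_(i < K) dotv v (Z i x) ^+ 2
                   <= w * normS Sigma v ^+ 2)]%R
   <= (expR (- (K%:R / 2 * (ln w - 1))))%:E)%E.
Proof.
move=> gaussZ meanZ covZ indepZ K3 ew.
have mZ i j : measurable_fun [set: T] (fun x => Z i x j 0).
  by apply: (measurableT_comp (measurable_coord j)); exact: measurable_funPT.
have mX i := measurable_dotv v (mZ i).
have lawX i B := @gaussian_dotv_law R N d T Pr (Z i) Sigma v B (mZ i) (gaussZ i)
  (meanZ i) (covZ i).
have indep (B : 'I_K -> set R) : (forall i, measurable (B i)) ->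
    Pr (\bigcap_i ((fun x => dotv v (Z i x)) @^-1` B i)) =
    (\prod_(i < K) normal_law 0 (normS Sigma v) (B i))%E.
  move=> mB.
  (* Preimages of Borel sets under [dotv v] are Borel sets of vectors, so independence passes to the
     scalar samples. *)
  have := indepZ (fun i => [set z : borelcV R N | B i (dotv v z)]).
  move=> -> => [|i].
    by apply: eq_bigr => i _; exact: lawX.
  rewrite -[X in measurable X]setTI.
  by apply: (measurable_dotv (T := borelcV R N) (Z := id) v (@measurable_coord R N)).
have [s0|s0] := eqVneq (normS Sigma v) 0; last first.
  apply: normal_sum_sqr_two_sided => //.
  by move=> B mB; rewrite indep//; apply: eq_bigr => i _; rewrite /normal_law (negbTE s0).
(* Degenerate direction of a singular [Sigma]: every sample has the Dirac law at 0, so almost surely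
   all three terms of the sandwich are 0. *)
rewrite s0 expr0n !mulr0.
have E1 : Pr (\bigcap_(i : 'I_K) ((fun x => dotv v (Z i x)) @^-1` [set 0])) = 1%E.
  rewrite (indep (fun=> [set 0]))//; apply: big1 => i _.
  by rewrite s0 /normal_law eqxx diracE mem_set.
set A := \bigcap_(i : 'I_K) _ in E1.
have mA : measurable A.
  apply: fin_bigcap_measurable => // i _.
  by rewrite -[X in measurable X]setTI; exact: mX.
have PAC : Pr (~` A) = 0%E by rewrite probability_setC// E1 subee.
rewrite (@le_trans _ _ (Pr (~` A)))//; last by rewrite PAC lee_fin expR_ge0.
have mS : measurable_fun [set: T] (fun x => K%:R^-1 * \sum_(i < K) dotv v (Z i x) ^+ 2).
  apply: measurable_funM => //; apply: measurable_sum => i.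
  exact: measurable_funX.
apply: le_measure; rewrite ?inE.
- rewrite (_ : [set x | _] = ~` ([set x | 0 <= K%:R^-1 * \sum_(i < K) dotv v (Z i x) ^+ 2]
     `&` [set x | K%:R^-1 * \sum_(i < K) dotv v (Z i x) ^+ 2 <= 0])); last first.
    by apply/seteqP; split=> x /=; [move/negP => h [a b]; apply: h; rewrite a
      |move=> h; apply/negP => /andP].
  by apply: measurableC; apply: measurableI; apply: measurable_set_ler.
- exact: measurableC.
- move=> x /= + Ax; apply/negP; rewrite negbK.
  rewrite big1 ?mulr0 ?lexx// => i _.
  by rewrite (Ax i I) expr0n.
Qed.

(** * Dual identity and deterministic comparison of ratios *)

Lemma dotv_dual (R : realType) (N : nat) (A : 'M[R]_N) (y z v : 'cV[R]_N) :
  A^T *m y = z -> dotv y (A *m v) = dotv v z.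
Proof.
move=> <-; rewrite /dotv mulmxA -[in RHS](trmxK (A^T *m y)) -trmx_mul [RHS]mxE.
by rewrite trmx_mul trmxK.
Qed.

Lemma normS_ge0 (R : realType) (N : nat) (S : 'M[R]_N) (v : 'cV[R]_N) :
  0 <= normS S v.
Proof. exact: sqrtr_ge0. Qed.

(** Numerator and denominator are each off by at most a factor [w], hence their quotient by
    [w ^+ 2]; the square root brings this back to [w]. *)
Lemma sqrt_ratio_sandwich (R : rcfType) (w E U qE qU : R) :
  0 < w -> 0 <= E -> 0 < U ->
  w^-1 * E ^+ 2 <= qE <= w * E ^+ 2 -> w^-1 * U ^+ 2 <= qU <= w * U ^+ 2 ->
  w^-1 * (E / U) <= Num.sqrt (qE / qU) <= w * (E / U).
Proof.
move=> w0 E0 U0 /andP[lE uE] /andP[lU uU].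
have wV0 : 0 < w^-1 by rewrite invr_gt0.
have U20 : 0 < U ^+ 2 by rewrite exprn_gt0.
have qU0 : 0 < qU by apply: lt_le_trans lU; exact: mulr_gt0.
have EU0 : 0 <= E / U by rewrite divr_ge0// ltW.
have sqrtK (x : R) : 0 <= x -> Num.sqrt (x ^+ 2) = x.
  by move=> x0; rewrite sqrtr_sqr ger0_norm.
apply/andP; split.
  rewrite -[leLHS]sqrtK; last exact: mulr_ge0 (ltW wV0) EU0.
  apply: ler_wsqrtr; rewrite ler_pdivlMr//; apply: le_trans lE.
  apply: (@le_trans _ _ ((w^-1 * (E / U)) ^+ 2 * (w * U ^+ 2))).
    by rewrite ler_wpM2l ?sqr_ge0.
  by rewrite le_eqVlt; apply/orP; left; apply/eqP; field; rewrite !gt_eqF.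
rewrite -[leRHS]sqrtK; last exact: mulr_ge0 (ltW w0) EU0.
apply: ler_wsqrtr; rewrite ler_pdivrMr//; apply: (le_trans uE).
apply: (@le_trans _ _ ((w * (E / U)) ^+ 2 * (w^-1 * U ^+ 2))).
  by rewrite le_eqVlt; apply/orP; left; apply/eqP; field; rewrite !gt_eqF.
by rewrite ler_wpM2l ?sqr_ge0.
Qed.

Lemma quasi_equiv_sandwich (R : realFieldType) (w a rho D Dt : R) :
  0 < w -> 0 < D -> 0 < Dt -> D / Dt <= a -> Dt / D <= a ->
  w^-1 * rho <= D <= w * rho ->
  (a * w)^-1 * Dt <= rho <= a * w * Dt.
Proof.
move=> w0 D0 Dt0; rewrite !ler_pdivrMr// => a1 a2.
rewrite ler_pdivrMl// => /andP[rD Dr].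
have a0 : 0 < a by rewrite -(pmulr_lgt0 _ Dt0) (lt_le_trans D0).
apply/andP; split.
  rewrite ler_pdivrMl ?mulr_gt0// -mulrA (le_trans a2)// ler_wpM2l//.
  exact: ltW.
by rewrite (le_trans rD)// mulrAC (mulrC (a * Dt)) ler_wpM2l// ltW.
Qed.

Lemma max_div_ge1 (R : realFieldType) (x y : R) : 0 < x -> 0 < y ->
  1 <= Num.max (x / y) (y / x).
Proof.
move=> x0 y0; rewrite le_max !ler_pdivlMr// !mul1r.
by case: (leP y x) => // /ltW ->; rewrite orbT.
Qed.

(** * Measurability of the estimators and of the factors [alpha] *)

Lemma measurable_funV_ge0 (R : realType) (d : measure_display)
    (T : measurableType d) (f : T -> R) :
  measurable_fun [set: T] f -> (forall x, 0 <= f x) ->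
  measurable_fun [set: T] (fun x => (f x)^-1).
Proof.
(* On nonnegative reals the inverse is the power with exponent -1, including at 0, where both take
   the value 0. *)
move=> mf f0; under eq_fun do rewrite -powR_inv1//.
by apply: (@measurableT_comp _ _ _ _ _ _ (fun y : R => y `^ (-1))) => //; exact: measurable_powR.
Qed.

Lemma measurable_sqrt (R : realType) (d : measure_display)
    (T : measurableType d) (f : T -> R) :
  measurable_fun [set: T] f -> measurable_fun [set: T] (fun x => Num.sqrt (f x)).
Proof.
apply: measurableT_comp; apply: continuous_measurable_fun.
exact: sqrt_continuous.
Qed.

Lemma measurable_bigmaxr (R : realType) (d : measure_display)
    (T : measurableType d) (I : Type) (s : seq I) (F : I -> T -> R) :
  (forall i, measurable_fun [set: T] (F i)) ->
  measurable_fun [set: T] (fun x => \big[Num.max/0]_(i <- s) F i x).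
Proof.
move=> mF; elim: s => [|i s IH].
  by under eq_fun do rewrite big_nil; exact: measurable_cst.
by under eq_fun do rewrite big_cons; exact: measurable_maxr.
Qed.

(** [G] lies in the union of [E] and a null set. This lets the concentration event be compared with
    the target event although the denominators are nonzero only almost surely. *)
Lemma ae_le_probability (R : realType) (d : measure_display)
    (T : measurableType d) (Pr : probability T R) (G E : set T) :
  measurable G -> measurable E -> {ae Pr, forall x, G x -> E x} ->
  (Pr G <= Pr E)%E.
Proof.
move=> mG mE [D [mD D0 sub]].
apply: (@le_trans _ _ (Pr (E `|` D))).
  apply: le_measure; rewrite ?inE//; first exact: measurableU.
  move=> x Gx; have [Ex|Ex] := pselect (E x); first by left.
  by right; apply: sub => /(_ Gx).
have PD0 : Pr D = 0%E by exact: D0.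
apply: (@le_trans _ _ (Pr E + Pr D)%E); first exact: measureU2.
by rewrite PD0 adde0.
Qed.

Lemma measurable_msq_at (R : realType) (d : measure_display)
    (Omega : measurableType d) (T : finType) (N K : nat)
    (Y : Omega -> T -> 'M[R]_(N, K)) (g : T -> 'cV[R]_N) (mu : T) :
  (forall mu j i, measurable_fun [set: Omega] (fun x => Y x mu j i)) ->
  measurable_fun [set: Omega] (fun x => msq_at (Y x) g mu).
Proof.
move=> mY; apply: measurable_funM => //; apply: measurable_sum => i.
apply: measurable_funX.
under eq_fun do rewrite dotvE.
apply: measurable_sum => j; apply: measurable_funM => //.
by under eq_fun do rewrite mxE; exact: mY.
Qed.

Lemma msqE (R : realType) (T : finType) (N K : nat) (Y : T -> 'M[R]_(N, K))
    (g : T -> 'cV[R]_N) : msq Y g = #|T|%:R^-1 * \sum_(mu : T) msq_at Y g mu.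
Proof.
by rewrite /msq /msq_at invfM -mulrA mulrCA mulr_sumr.
Qed.

Lemma msq_at_ge0 (R : realType) (T : finType) (N K : nat) (Y : T -> 'M[R]_(N, K))
    (g : T -> 'cV[R]_N) (mu : T) : 0 <= msq_at Y g mu.
Proof.
by rewrite /msq_at mulr_ge0 ?invr_ge0 ?ler0n// sumr_ge0// => i _; rewrite sqr_ge0.
Qed.

Lemma msq_ge0 (R : realType) (T : finType) (N K : nat) (Y : T -> 'M[R]_(N, K))
    (g : T -> 'cV[R]_N) : 0 <= msq Y g.
Proof.
by rewrite msqE mulr_ge0 ?invr_ge0 ?ler0n// sumr_ge0// => mu _; exact: msq_at_ge0.
Qed.

Lemma measurable_Delta_at (R : realType) (d : measure_display)
    (Omega : measurableType d) (T : finType) (N K : nat)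
    (Y : Omega -> T -> 'M[R]_(N, K)) (r f : T -> 'cV[R]_N) (mu : T) :
  (forall mu j i, measurable_fun [set: Omega] (fun x => Y x mu j i)) ->
  measurable_fun [set: Omega] (fun x => Delta_at (Y x) r f mu).
Proof.
move=> mY; apply: measurable_sqrt; apply: measurable_funM.
  exact: measurable_msq_at.
apply: measurable_funV_ge0; first exact: measurable_msq_at.
by move=> x; exact: msq_at_ge0.
Qed.

Lemma measurable_Delta (R : realType) (d : measure_display)
    (Omega : measurableType d) (T : finType) (N K : nat)
    (Y : Omega -> T -> 'M[R]_(N, K)) (r f : T -> 'cV[R]_N) :
  (forall mu j i, measurable_fun [set: Omega] (fun x => Y x mu j i)) ->
  measurable_fun [set: Omega] (fun x => Delta (Y x) r f).
Proof.
move=> mY.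
have mmsq g : measurable_fun [set: Omega] (fun x => msq (Y x) g).
  under eq_fun do rewrite msqE.
  apply: measurable_funM => //; apply: measurable_sum => mu.
  exact: measurable_msq_at.
apply: measurable_sqrt; apply: measurable_funM => //.
by apply: measurable_funV_ge0 => // x; exact: msq_ge0.
Qed.

Lemma measurable_max_ratio (R : realType) (d : measure_display)
    (Omega : measurableType d) (f g : Omega -> R) :
  measurable_fun [set: Omega] f -> measurable_fun [set: Omega] g ->
  (forall x, 0 <= f x) -> (forall x, 0 <= g x) ->
  measurable_fun [set: Omega] (fun x => Num.max (f x / g x) (g x / f x)).
Proof.
move=> mf mg f0 g0.
by apply: measurable_maxr; apply: measurable_funM => //; exact: measurable_funV_ge0.
Qed.

Lemma Delta_at_ge0 (R : realType) (T : finType) (N K : nat)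
    (Y : T -> 'M[R]_(N, K)) (r f : T -> 'cV[R]_N) (mu : T) :
  0 <= Delta_at Y r f mu.
Proof. exact: sqrtr_ge0. Qed.

Lemma Delta_ge0 (R : realType) (T : finType) (N K : nat)
    (Y : T -> 'M[R]_(N, K)) (r f : T -> 'cV[R]_N) : 0 <= Delta Y r f.
Proof. exact: sqrtr_ge0. Qed.

Lemma measurable_alpha_infty (R : realType) (d : measure_display)
    (Omega : measurableType d) (T : finType) (N K : nat)
    (Y Yt : Omega -> T -> 'M[R]_(N, K)) (r f : T -> 'cV[R]_N) :
  (forall mu j i, measurable_fun [set: Omega] (fun x => Y x mu j i)) ->
  (forall mu j i, measurable_fun [set: Omega] (fun x => Yt x mu j i)) ->
  measurable_fun [set: Omega] (fun x => alpha_infty (Y x) (Yt x) r f).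
Proof.
move=> mY mYt; apply: measurable_bigmaxr => mu.
by apply: measurable_max_ratio => [||x|x];
   [exact: measurable_Delta_at..|exact: Delta_at_ge0|exact: Delta_at_ge0].
Qed.

Lemma measurable_alpha_2 (R : realType) (d : measure_display)
    (Omega : measurableType d) (T : finType) (N K : nat)
    (Y Yt : Omega -> T -> 'M[R]_(N, K)) (r f : T -> 'cV[R]_N) :
  (forall mu j i, measurable_fun [set: Omega] (fun x => Y x mu j i)) ->
  (forall mu j i, measurable_fun [set: Omega] (fun x => Yt x mu j i)) ->
  measurable_fun [set: Omega] (fun x => alpha_2 (Y x) (Yt x) r f).
Proof.
move=> mY mYt.
by apply: measurable_max_ratio => [||x|x];
   [exact: measurable_Delta..|exact: Delta_ge0|exact: Delta_ge0].
Qed.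

(** * Mean squares of dual samples, sample size and union bound *)

Lemma msq_at_dual (R : realType) (T : finType) (N K : nat) (A : 'M[R]_N)
    (Y : T -> 'M[R]_(N, K)) (z : 'I_K -> 'cV[R]_N) (g : T -> 'cV[R]_N)
    (v : 'cV[R]_N) (mu : T) :
  (forall i, A^T *m col i (Y mu) = z i) -> g mu = A *m v ->
  msq_at Y g mu = K%:R^-1 * \sum_(i < K) dotv v (z i) ^+ 2.
Proof.
move=> hY hg; congr (_ * _); apply: eq_bigr => i _.
by rewrite hg (dotv_dual v (hY i)).
Qed.

Lemma rms_norm_sqr (R : realType) (T : finType) (N : nat) (S : 'M[R]_N)
    (g : T -> 'cV[R]_N) :
  rms_norm S g ^+ 2 = #|T|%:R^-1 * \sum_(mu : T) normS S (g mu) ^+ 2.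
Proof.
by rewrite sqr_sqrtr// mulr_ge0 ?invr_ge0 ?ler0n// sumr_ge0// => mu _; rewrite sqr_ge0.
Qed.

Lemma msq_sandwich (R : realType) (T : finType) (N K : nat) (S : 'M[R]_N)
    (Y : T -> 'M[R]_(N, K)) (g v : T -> 'cV[R]_N) (a b : R) :
  (forall mu, a * normS S (v mu) ^+ 2 <= msq_at Y g mu <= b * normS S (v mu) ^+ 2) ->
  a * rms_norm S v ^+ 2 <= msq Y g <= b * rms_norm S v ^+ 2.
Proof.
move=> h; rewrite rms_norm_sqr msqE !(mulrCA _ #|T|%:R^-1) !mulr_sumr.
by apply/andP; split; apply: ler_sum => mu _; rewrite ler_wpM2l ?invr_ge0 ?ler0n//;
   case/andP: (h mu).
Qed.

(** Since [ln (w / e) = ln w - 1] is positive, the condition on [K] exponentiates to [2 * n / delta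
    <= expR (K / 2 * (ln w - 1))]. The factor [n * 2] counts the vectors in the union bound. *)
Lemma sample_size_bound (R : realType) (n K : nat) (delta w : R) :
  (0 < n)%N -> 0 < delta -> expR 1 < w ->
  (2 * ln (2 * n%:R) + 2 * ln delta^-1) / ln (w / expR 1) <= K%:R ->
  (n * 2)%:R * expR (- (K%:R / 2 * (ln w - 1))) <= delta.
Proof.
move=> n0 d0 ew.
have w0 : 0 < w by apply: lt_trans ew; exact: expR_gt0.
have nR0 : 0 < 2 * n%:R :> R by rewrite mulr_gt0// ltr0n.
rewrite ln_div ?posrE ?expR_gt0// expRK.
have lnw : 0 < ln w - 1.
  by rewrite subr_gt0 -ltr_expR lnK.
rewrite ler_pdivrMr// -mulrDr -lnM ?posrE ?invr_gt0// => h.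
have {}h : ln (2 * n%:R * delta^-1) <= K%:R / 2 * (ln w - 1) by lra.
have {}h : 2 * n%:R * delta^-1 <= expR (K%:R / 2 * (ln w - 1)).
  by rewrite -[leLHS]lnK ?posrE ?ler_expR// mulr_gt0 ?invr_gt0.
rewrite ler_pdivrMr// in h.
by rewrite expRN ler_pdivrMr ?expR_gt0// natrM mulrC (mulrC delta).
Qed.

(** Union bound by induction on a list of indices: the intersection over [s] is covered by the
    intersection over [i :: s] and the complement of [A i], so each index costs at most [c]. *)
Lemma forall_prob_ge (R : realType) (d : measure_display)
    (Omega : measurableType d) (Pr : probability Omega R) (I : finType)
    (A : I -> set Omega) (c : R) :
  (forall i, measurable (A i)) -> (forall i, (Pr (~` A i) <= c%:E)%E) ->
  ((1 - #|I|%:R * c)%:E <= Pr [set x | forall i, A i x])%E.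
Proof.
move=> mA hA.
pose G (s : seq I) : set Omega := \bigcap_(i in [set` s]) A i.
have mG s : measurable (G s) by apply: fin_bigcap_measurable.
suff main s : (1 <= Pr (G s) + ((size s)%:R * c)%:E)%E.
  have -> : [set x | forall i, A i x] = G (enum I).
    by apply/seteqP; split=> x h i; [move=> _; exact: h|apply: h; rewrite /= mem_enum].
  by rewrite EFinB leeBlDr// cardE; exact: main.
elim: s => [|i s IH].
  by rewrite /G set_nil bigcap_set0 mul0r adde0 probability_setT.
apply: (le_trans IH); rewrite /= -natr1 mulrDl mul1r EFinD (addeC (_ * _)%:E) addeA.
rewrite leeD2r//; apply: (@le_trans _ _ (Pr (G (i :: s) `|` ~` A i))).
  apply: le_measure; rewrite ?inE//.
    by apply: measurableU => //; exact: measurableC.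
  move=> x Gx; have [Ax|nAx] := pselect (A i x); last by right.
  by left=> j /=; rewrite inE => /orP[/eqP->//|js]; exact: Gx.
apply: (@le_trans _ _ (Pr (G (i :: s)) + Pr (~` A i))%E).
  by apply: measureU2 => //; exact: measurableC.
by rewrite leeD2l.
Qed.

Lemma measurable_sandwich (R : realType) (d : measure_display)
    (Omega : measurableType d) (a D : Omega -> R) (w c : R) :
  measurable_fun [set: Omega] a -> measurable_fun [set: Omega] D ->
  (forall x, 0 <= a x) -> 0 <= w ->
  measurable [set x | (a x * w)^-1 * D x <= c <= a x * w * D x].
Proof.
move=> ma mD a0 w0.
have maw : measurable_fun [set: Omega] (fun x => a x * w) by exact: measurable_funM.
rewrite (_ : [set x | _] = [set x | (a x * w)^-1 * D x <= c] `&`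
    [set x | c <= a x * w * D x]); last by apply/seteqP; split=> x /andP.
apply: measurableI; apply: measurable_set_ler => //; apply: measurable_funM => //.
by apply: measurable_funV_ge0 => // x; rewrite mulr_ge0.
Qed.

(** * The concentration event and its consequences for both estimators *)

Lemma relative_estimators (R : realType) (T : finType) (N K : nat)
    (A : T -> 'M[R]_N) (f u ut : T -> 'cV[R]_N) (Sigma : 'M[R]_N)
    (d : measure_display) (Omega : measurableType d) (Pr : probability Omega R)
    (Z : 'I_K -> {RV Pr >-> borelcV R N}) (Y Yt : Omega -> T -> 'M[R]_(N, K))
    (r := residual A f ut) (delta w : R) :
  (0 < #|T|)%N -> (forall mu, A mu \in unitmx) ->
  (forall mu, A mu *m u mu = f mu) -> (forall mu, normS Sigma (u mu) != 0) ->
  (forall i, gaussian_vector Pr (Z i)) -> (forall i, has_mean Pr (Z i) 0) ->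
  (forall i, has_covariance Pr (Z i) Sigma) -> independent_vectors Pr Z ->
  (forall x mu i, (A mu)^T *m col i (Y x mu) = Z i x) ->
  (forall mu j k, measurable_fun [set: Omega] (fun x => Yt x mu j k)) ->
  {ae Pr, forall x, denominators_neq0 (Y x) (Yt x) r f} ->
  0 < delta -> expR 1 < w ->
  Num.max ((2 * ln (2 * #|T|%:R) + 2 * ln delta^-1) / ln (w / expR 1)) 3 <= K%:R ->
  [/\ ((1 - delta)%:E <=
        Pr [set x | forall mu,
          ((alpha_infty (Y x) (Yt x) r f * w)^-1 * Delta_at (Yt x) r f mu
             <= normS Sigma (u mu - ut mu) / normS Sigma (u mu)
             <= (alpha_infty (Y x) (Yt x) r f * w) * Delta_at (Yt x) r f mu)%R])%E,
      ((1 - delta)%:E <=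
        Pr [set x |
          ((alpha_2 (Y x) (Yt x) r f * w)^-1 * Delta (Yt x) r f
             <= rms_norm Sigma (fun mu => u mu - ut mu) / rms_norm Sigma u
             <= (alpha_2 (Y x) (Yt x) r f * w) * Delta (Yt x) r f)%R])%E,
      {ae Pr, forall x, 1 <= alpha_infty (Y x) (Yt x) r f} &
      {ae Pr, forall x, 1 <= alpha_2 (Y x) (Yt x) r f}].
Proof.
move=> T0 unitA hu hu0 gaussZ meanZ covZ indepZ hY mYt hden delta0 ew.
rewrite ge_max => /andP[hK K3].
have {}K3 : (3 <= K)%N by rewrite -(ler_nat R).
have w0 : 0 < w by apply: lt_trans ew; exact: expR_gt0.
have mZ i j : measurable_fun [set: Omega] (fun x => Z i x j 0).
  by apply: (measurableT_comp (measurable_coord j)); exact: measurable_funPT.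
have mY mu j i : measurable_fun [set: Omega] (fun x => Y x mu j i).
  (* The dual solutions are given only through their equation; invertibility of [A mu] makes their
     entries linear in [Z], hence measurable. *)
  have YE x : Y x mu j i = \sum_k invmx (A mu)^T j k * Z i x k 0.
    have -> : Y x mu j i = col i (Y x mu) j 0 by rewrite mxE.
    by rewrite -(mulKmx (_ : (A mu)^T \in unitmx) (col i _)) ?unitmx_tr// hY mxE.
  under eq_fun do rewrite YE.
  by apply: measurable_sum => k; exact: measurable_funM.
pose e mu := u mu - ut mu.
have hr mu : r mu = A mu *m e mu by rewrite /r /residual mulmxBr hu.
(* The boolean selects the solution or the error, so one index type of size [#|T| * 2] lists all
   vectors of the union bound. *)
pose v (p : T * bool) := if p.2 then u p.1 else e p.1.
pose B p := [set x | w^-1 * normS Sigma (v p) ^+ 2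
  <= K%:R^-1 * \sum_(i < K) dotv (v p) (Z i x) ^+ 2 <= w * normS Sigma (v p) ^+ 2].
have mB p : measurable (B p).
  have mQ : measurable_fun [set: Omega]
      (fun x => K%:R^-1 * \sum_(i < K) dotv (v p) (Z i x) ^+ 2).
    apply: measurable_funM => //; apply: measurable_sum => i.
    by apply: measurable_funX; exact: measurable_dotv.
  rewrite (_ : B p = [set x | w^-1 * normS Sigma (v p) ^+ 2
      <= K%:R^-1 * \sum_(i < K) dotv (v p) (Z i x) ^+ 2] `&`
    [set x | K%:R^-1 * \sum_(i < K) dotv (v p) (Z i x) ^+ 2
      <= w * normS Sigma (v p) ^+ 2]); last first.
    by apply/seteqP; split=> x /andP.
  by apply: measurableI; exact: measurable_set_ler.
pose G := [set x | forall p, B p x].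
have mG : measurable G.
  rewrite (_ : G = \bigcap_p B p); first exact: fin_bigcap_measurable.
  by apply/seteqP; split=> x h p; [move=> _; exact: h|exact: h].
have PG : ((1 - delta)%:E <= Pr G)%E.
  apply: (@le_trans _ _ (1 - #|{: T * bool}|%:R * expR (- (K%:R / 2 * (ln w - 1))))%:E).
    rewrite lee_fin lerB// card_prod card_bool.
    exact: sample_size_bound.
  apply: forall_prob_ge => // p.
  have -> : ~` B p = [set x | ~~ (w^-1 * normS Sigma (v p) ^+ 2
      <= K%:R^-1 * \sum_(i < K) dotv (v p) (Z i x) ^+ 2 <= w * normS Sigma (v p) ^+ 2)].
    by apply/seteqP; split=> x /negP.
  exact: (sample_norm_two_sided (v p) gaussZ meanZ covZ indepZ K3 (ltW ew)).
have Gu x mu : G x -> w^-1 * normS Sigma (u mu) ^+ 2 <= msq_at (Y x) f mu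
    <= w * normS Sigma (u mu) ^+ 2.
  by move=> /(_ (mu, true)); rewrite /B /= -(msq_at_dual (hY x mu) (esym (hu mu))).
have Ge x mu : G x -> w^-1 * normS Sigma (e mu) ^+ 2 <= msq_at (Y x) r mu
    <= w * normS Sigma (e mu) ^+ 2.
  by move=> /(_ (mu, false)); rewrite /B /= -(msq_at_dual (hY x mu) (hr mu)).
have u0 mu : 0 < normS Sigma (u mu) by rewrite lt_neqAle eq_sym hu0 normS_ge0.
have rms0 : 0 < rms_norm Sigma u.
  rewrite sqrtr_gt0 mulr_gt0 ?invr_gt0 ?ltr0n//.
  (* A single parameter suffices for positivity, since its term is positive and the others are
     nonnegative. *)
  have /card_gt0P[mu _] := T0.
  rewrite (bigD1 mu)//= ltr_pwDl ?exprn_gt0// sumr_ge0// => ? _; exact: sqr_ge0.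
have GD x mu : G x -> w^-1 * (normS Sigma (e mu) / normS Sigma (u mu))
    <= Delta_at (Y x) r f mu <= w * (normS Sigma (e mu) / normS Sigma (u mu)).
  by move=> Gx; apply: sqrt_ratio_sandwich; rewrite ?normS_ge0 ?Ge ?Gu.
have GD2 x : G x -> w^-1 * (rms_norm Sigma e / rms_norm Sigma u)
    <= Delta (Y x) r f <= w * (rms_norm Sigma e / rms_norm Sigma u).
  move=> Gx; apply: sqrt_ratio_sandwich => //; first exact: sqrtr_ge0.
    by apply: msq_sandwich => mu; exact: Ge.
  by apply: msq_sandwich => mu; exact: Gu.
have Dat0 Y' mu : Delta_at Y' r f mu != 0 -> 0 < Delta_at Y' r f mu.
  by move=> h; rewrite lt_neqAle eq_sym h Delta_at_ge0.
have D0 (Y' : T -> 'M[R]_(N, K)) : Delta Y' r f != 0 -> 0 < Delta Y' r f.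
  by move=> h; rewrite lt_neqAle eq_sym h Delta_ge0.
have mainf := measurable_alpha_infty r f mY mYt.
have ma2 := measurable_alpha_2 r f mY mYt.
have ainf_ge x mu : Num.max (Delta_at (Y x) r f mu / Delta_at (Yt x) r f mu)
    (Delta_at (Yt x) r f mu / Delta_at (Y x) r f mu) <= alpha_infty (Y x) (Yt x) r f.
  exact: le_bigmax.
split.
- apply: (le_trans PG); apply: ae_le_probability => //.
    rewrite (_ : [set x | _] = \bigcap_mu [set x |
        (alpha_infty (Y x) (Yt x) r f * w)^-1 * Delta_at (Yt x) r f mu
          <= normS Sigma (u mu - ut mu) / normS Sigma (u mu)
          <= alpha_infty (Y x) (Yt x) r f * w * Delta_at (Yt x) r f mu]).
      apply: fin_bigcap_measurable => // mu _.
      apply: measurable_sandwich => // [|x|]; last exact: ltW.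
        exact: measurable_Delta_at.
      (* The default value 0 of the maximum makes [alpha_infty] nonnegative at every outcome,
         including those where a denominator vanishes. *)
      exact: bigmax_ge_id.
    by apply/seteqP; split=> x h mu; [move=> _; exact: h|exact: h].
  apply: filterS hden => x [hat _] Gx mu; have [_ _ /Dat0 h1 /Dat0 h2] := hat mu.
  apply: quasi_equiv_sandwich h1 h2 _ _ (GD _ _ Gx) => //.
    by apply: le_trans (ainf_ge x mu); rewrite le_max lexx.
  by apply: le_trans (ainf_ge x mu); rewrite le_max lexx orbT.
- apply: (le_trans PG); apply: ae_le_probability => //.
    apply: measurable_sandwich => // [|x|]; last exact: ltW.
      exact: measurable_Delta.
    by rewrite /alpha_2 le_max divr_ge0 ?Delta_ge0.
  apply: filterS hden => x [_ [_ _ /D0 h1 /D0 h2]] Gx.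
  apply: quasi_equiv_sandwich h1 h2 _ _ (GD2 _ Gx) => //.
    by rewrite /alpha_2 le_max lexx.
  by rewrite /alpha_2 le_max lexx orbT.
- apply: filterS hden => x [hat _]; have /card_gt0P[mu _] := T0.
  apply: le_trans (ainf_ge x mu); have [_ _ /Dat0 h1 /Dat0 h2] := hat mu.
  exact: max_div_ge1.
- apply: filterS hden => x [_ [_ _ /D0 h1 /D0 h2]].
  exact: max_div_ge1.
Qed.

Theorem proposition4p2 (R : realType) (p N K M L : nat)
  (P : 'I_p -> {fset R}) (hP : (0 < #|{: param P}|)%N)
  (A : param P -> 'M[R]_N) (hA : forall mu, A mu \in unitmx)
  (f u : param P -> 'cV[R]_N) (hu : forall mu, A mu *m u mu = f mu)
  (uX : 'I_M -> 'cV[R]_N) (ui : 'I_M -> forall i, P i -> R)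
  (ut : param P -> 'cV[R]_N) (hut : forall mu, ut mu = separated_form uX ui mu)
  (Sigma : 'M[R]_N) (hSigma_sym : Sigma^T = Sigma) (hSigma_psd : is_psd Sigma)
  (hu_neq0 : forall mu, normS Sigma (u mu) != 0)
  (d : measure_display) (Omega : measurableType d) (Pr : probability Omega R)
  (Z : 'I_K -> {RV Pr >-> borelcV R N})
  (hZ_gauss : forall i, gaussian_vector Pr (Z i))
  (hZ_mean : forall i, has_mean Pr (Z i) 0)
  (hZ_cov : forall i, has_covariance Pr (Z i) Sigma)
  (hZ_indep : independent_vectors Pr Z)
  (Y : Omega -> param P -> 'M[R]_(N, K))
  (hY : forall w mu i, (A mu)^T *m col i (Y w mu) = Z i w)
  (YX : Omega -> 'I_L -> 'M[R]_(N, K))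
  (Yi : Omega -> 'I_L -> forall i, P i -> R)
  (Yt : Omega -> param P -> 'M[R]_(N, K))
  (hYt : forall w mu, Yt w mu = separated_form (YX w) (Yi w) mu)
  (hYt_meas : forall mu j k,
     measurable_fun [set: Omega] (fun w => Yt w mu j k))
  (r := residual A f ut)
  (hden : {ae Pr, forall w, denominators_neq0 (Y w) (Yt w) r f})
  (delta w : R) (hdelta : 0 < delta < 1) (hw : expR 1 < w)
  (hK : Num.max ((2 * ln (2 * #|{: param P}|%:R) + 2 * ln delta^-1)
                   / ln (w / expR 1)) 3 <= K%:R)
  (ainf := fun x => alpha_infty (Y x) (Yt x) r f)
  (a2 := fun x => alpha_2 (Y x) (Yt x) r f) :
  [/\ ((1 - delta)%:E <=
        Pr [set x | forall mu : param P,
          ((ainf x * w)^-1 * Delta_at (Yt x) r f mu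
             <= normS Sigma (u mu - ut mu) / normS Sigma (u mu)
             <= (ainf x * w) * Delta_at (Yt x) r f mu)%R])%E,
      ((1 - delta)%:E <=
        Pr [set x |
          ((a2 x * w)^-1 * Delta (Yt x) r f
             <= rms_norm Sigma (fun mu => u mu - ut mu) / rms_norm Sigma u
             <= (a2 x * w) * Delta (Yt x) r f)%R])%E,
      {ae Pr, forall x, 1 <= ainf x} &
      {ae Pr, forall x, 1 <= a2 x}].
Proof.
case/andP: hdelta => delta0 _.
exact: (relative_estimators hP hA hu hu_neq0 hZ_gauss hZ_mean hZ_cov hZ_indep hY
  hYt_meas hden delta0 hw hK).
Qed.
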